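(* In the two-player continuous game, the first black hat strategy $f_0$ is a best response to itself, i.e. $$\sup_{g\in\widehat{\mathcal M}_1}P_{f_0,g}=P_{f_0,f_0}.$$ Therefore there exist strategies $f\in\widehat{\mathcal M}_1$ for which a best response can be found within the class $2^{\widehat{\mathcal S}_1}$, i.e. for which there is $g\in 2^{\widehat{\mathcal S}_1}$ with $P_{f,g}=\sup_{g'\in\widehat{\mathcal M}_1}P_{f,g'}$.
   Context: $\widehat{\mathcal M}_1$ is the set of measurable non-negative (real-valued) functions on $[0,1]$. $\widehat{\mathcal S}_1$ is the set of Lebesgue-measurable functions $k:[0,1[\to\mathbb N^*=\{1,2,\dots\}$, and $2^{\widehat{\mathcal S}_1}$ is the set of functions $x\mapsto2^{k(x)}$ with $k\in\widehat{\mathcal S}_1$; functions are regarded up to almost-everywhere equality, so values at the endpoints of $[0,1]$ are irrelevant. For real $x$, $\varepsilon(x):=\lfloor x\rfloor-2\lfloor x/2\rfloor\in\{0,1\}$. For $f,g\in\widehat{\mathcal M}_1$, $$P_{f,g}:=\int_{[0,1]^2}\varepsilon(f(y)x)\,\varepsilon(g(x)y)\,\mathrm dx\,\mathrm dy.$$ The first black hat strategy is $f_0(y)=2^{-\lfloor\log_2(y)\rfloor}$ for $y\in\,]0,1[$ (equivalently, $f_0(y)=2^p$ for $y\in[2^{-p},2^{-(p-1)}[$, $p\ge1$). *)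

(* Defs.v *)
From mathcomp Require Import all_boot all_order all_algebra.
From mathcomp Require Import all_classical all_reals all_analysis.

Set Implicit Arguments.
Unset Strict Implicit.
Unset Printing Implicit Defensive.

Import Order.TTheory GRing.Theory Num.Theory.
Import numFieldNormedType.Exports.

Local Open Scope classical_set_scope.
Local Open Scope ring_scope.

(** The real line with the Lebesgue sigma-algebra, i.e. the measurable space
    carrying [completed_lebesgue_measure]; the bare [R] has the Borel one. *)
Definition lebesgueR (R : realType) : measurableType _ :=
  caratheodory_type (@wlength R idfun)^*%mu.

(** Strategies are functions on the whole of [R] constrained on the unit
    interval only. They are genuine functions, not classes modulo almost
    everywhere equality; their values outside the unit interval are never
    used. *)
Definition M1 (R : realType) : set (R -> R) :=
  [set f : R -> R |
    measurable_fun (`[0, 1] : set (lebesgueR R)) (f : lebesgueR R -> R) /\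
    forall x : R, x \in `[0, 1] -> 0 <= f x].

Definition S1 (R : realType) : set (R -> nat) :=
  [set k : R -> nat |
    measurable_fun (`[0, 1[ : set (lebesgueR R)) (k : lebesgueR R -> nat) /\
    forall x : R, x \in `[0, 1[ -> (0 < k x)%N].

Definition pow2S1 (R : realType) : set (R -> R) :=
  [set (fun x => 2 ^+ k x) | k in @S1 R].

Definition eps (R : realType) (x : R) : int :=
  Num.floor x - 2 * Num.floor (x / 2).

(** The points of the square are [z = (x, y)]. The value lies between 0 and 1;
    it is kept in [\bar R] so that suprema are taken by [ereal_sup]. *)
Definition payoff (R : realType) (f g : R -> R) : \bar R :=
  (\int[@completed_lebesgue_measure R \x @completed_lebesgue_measure R]_(z in
       (`[0%R, 1%R] : set (lebesgueR R)) `*`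
       (`[0%R, 1%R] : set (lebesgueR R)))
     ((eps (f z.2 * z.1))%:~R * (eps (g z.1 * z.2))%:~R)%R%:E)%E.

(** Since [ln 0 = 0], this gives [first_black_hat 0 = first_black_hat 1 = 1];
    the endpoints form a null set. *)
Definition first_black_hat (R : realType) (y : R) : R :=
  2 ^ (- Num.floor (ln y / ln 2)).

(* Main.v *)
Require Import Defs.
From mathcomp Require Import all_boot all_order all_algebra.
From mathcomp Require Import all_classical all_reals all_analysis.
From mathcomp Require Import measurable_realfun.
From mathcomp Require Import lra zify.

Set Implicit Arguments.
Unset Strict Implicit.
Unset Printing Implicit Defensive.

Import Order.TTheory GRing.Theory Num.Theory.
Import numFieldNormedType.Exports.

Local Open Scope classical_set_scope.
Local Open Scope ring_scope.

(** Write f0 for the first black hat. Fix x in ]0, 1[ and let f0(x) = 2^q, so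
    that the q-th binary digit of x is its first nonzero one. Against f0,
    answering c at the point x earns
      gain x c = int_0^1 eps(f0(y) x) eps(c y) dy,
    and eps(f0(y) x) is the p-th binary digit of x when y lies in
    [2^-p, 2^(1-p)[. By Tonelli the payoff is the integral of the gain over x,
    so it suffices to maximize the gain separately for each x.

    Put a = 2^(1-q). For y >= a the digit eps(f0(y) x) comes before the first
    nonzero one, so it vanishes and the gain is at most the measure of the y in
    [0, a[ where eps(c y) = 1. Such points fill every other interval of length
    1/c, starting with an empty one, so they occupy at most half of [0, a[,
    whatever c is: the gain is at most a / 2 = 2^-q
    ([integral_eps_half], [gain_black_hat_le]).

    The answer c = 2^q reaches this bound: on [2^-q, 2^(1-q)[, an interval of
    length 2^-q, the black hat at y is 2^q too, and both factors are 1
    ([gain_black_hat_ge]).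

    For the second claim, the black hat is itself of the form 2^k on ]0, 1[;
    only the exponent at 0 has to be raised to a positive value, and a single
    point does not change the payoff. *)

(** * The binary digit function *)

Lemma eps_even_block (R : realType) (n : nat) (t : R) :
  (2 * n)%:R <= t < (2 * n)%:R + 1 -> eps t = 0.
Proof.
rewrite natrM => /andP[t0 t1].
rewrite /eps (@floor_def _ t (2 * n)%N) ?(@floor_def _ (t / 2) n).
- by rewrite PoszM subrr.
- by rewrite intrD -pmulrn; lra.
- by rewrite intrD -pmulrn natrM; lra.
Qed.

Lemma eps_lt1 (R : realType) (t : R) : 0 <= t < 1 -> eps t = 0.
Proof. by move=> t01; apply: (@eps_even_block _ 0); rewrite muln0 add0r. Qed.

Lemma eps_ge1_lt2 (R : realType) (t : R) : 1 <= t < 2 -> eps t = 1.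
Proof.
move=> /andP[t0 t1].
by rewrite /eps (@floor_def _ t 1) ?(@floor_def _ (t / 2) 0)//=; lra.
Qed.

Lemma eps_bounds (R : realType) (t : R) : 0 <= eps t <= 1.
Proof.
rewrite /eps; set m := Num.floor t; set n := Num.floor (t / 2).
have /andP[m1 m2] := floor_itv t; have /andP[n1 n2] := floor_itv (t / 2).
rewrite -/m -/n in m1 m2 n1 n2.
have h1 : (2 * n)%:~R < (m + 1)%:~R :> R by rewrite intrM; lra.
have h2 : m%:~R < (2 * (n + 1))%:~R :> R by rewrite intrM; lra.
by move: h1 h2; rewrite !ltr_int; lia.
Qed.

Lemma eps_ge0 (R : realType) (t : R) : 0 <= (eps t)%:~R :> R.
Proof. by rewrite ler0z; have /andP[] := eps_bounds t. Qed.

Lemma eps_le1 (R : realType) (t : R) : (eps t)%:~R <= 1 :> R.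
Proof. by rewrite (ler_int _ _ 1); have /andP[] := eps_bounds t. Qed.

Lemma measurable_floor (R : realType) :
  measurable_fun setT (fun t : R => (Num.floor t)%:~R : R).
Proof.
apply: nondecreasing_measurable => // s t st.
by rewrite ler_int; apply: le_floor.
Qed.

Lemma measurable_eps (R : realType) :
  measurable_fun setT (fun t : R => (eps t)%:~R : R).
Proof.
rewrite /eps; under eq_fun do rewrite intrB intrM.
apply: measurable_funB; first exact: measurable_floor.
apply: measurable_funM; first exact: measurable_cst.
apply: (measurableT_comp (@measurable_floor R)).
by apply: measurable_funM => //; exact: measurable_cst.
Qed.

(** * Arithmetic of the first black hat *)

Lemma exprz2E (R : realType) (z : int) : 2 ^ z = expR (z%:~R * ln 2) :> R.
Proof. by rewrite -powR_intmul// /powR pnatr_eq0. Qed.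

Lemma black_hat_gt0 (R : realType) (y : R) : 0 < first_black_hat y.
Proof. by rewrite /first_black_hat exprz_gt0. Qed.

(** This characterizes the black hat: there is a single power of 2 that brings
    a positive y into [1, 2[. *)
Lemma black_hat_bracket (R : realType) (y : R) :
  0 < y -> 1 <= first_black_hat y * y < 2.
Proof.
move=> y0; rewrite /first_black_hat exprz2E -{2 4}(lnK y0) -expRD.
have ln2 : 0 < ln 2 :> R by rewrite ln_gt0// ltr1n.
set l := ln y / ln 2; have -> : ln y = l * ln 2 by rewrite divfK// gt_eqF.
rewrite -mulrDl intrN.
have /andP[l1 l2] := floor_itv l; rewrite intrD mulr1z in l2.
apply/andP; split.
  rewrite -[leLHS]expR0 ler_expR mulr_ge0// ?(ltW ln2)//.
  by rewrite addrC subr_ge0.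
have e2 : expR (ln 2) = 2 :> R by rewrite lnK// posrE.
by rewrite -[X in _ < X]e2 ltr_expR gtr_pMl// addrC ltrBlDl.
Qed.

(** Black hat values are integral powers of 2, hence differ by a factor of at
    least 2 as soon as they differ. *)
Lemma black_hat_gap (R : realType) (x y : R) :
  first_black_hat x < first_black_hat y ->
  2 * first_black_hat x <= first_black_hat y.
Proof.
rewrite /first_black_hat; set p := - _; set q := - Num.floor (ln y / _).
have -> : 2 * 2 ^ p = 2 ^ (p + 1) :> R by rewrite expfzDr// expr1z mulrC.
by rewrite ltr_eXz2l ?ltr1n// ler_eXz2l ?ltr1n// lezD1.
Qed.

Lemma black_hat_ge2 (R : realType) (x : R) : 0 < x < 1 -> 2 <= first_black_hat x.
Proof.
move=> /andP[x0 x1]; have := black_hat_gap (x := 1) (y := x).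
have -> : first_black_hat 1 = 1 :> R.
  by rewrite /first_black_hat ln1 mul0r floor0.
rewrite mulr1; apply; have := black_hat_bracket x0.
have := black_hat_gt0 x; nra.
Qed.

Lemma black_hat_same_block (R : realType) (x y : R) :
  0 < y -> 1 <= first_black_hat x * y < 2 -> first_black_hat y = first_black_hat x.
Proof.
move=> y0 xy; have yy := black_hat_bracket y0.
by have [/black_hat_gap|/black_hat_gap|//] :=
  ltgtP (first_black_hat y) (first_black_hat x); nra.
Qed.

(** A digit of x strictly before its first nonzero one vanishes: y lies in a
    dyadic block strictly above that of x, so that f0(y) <= f0(x) / 2 and
    f0(y) x < 1. *)
Lemma black_hat_digit0 (R : realType) (x y : R) : 0 < x -> 0 < y ->
  2 <= first_black_hat x * y -> eps (first_black_hat y * x) = 0.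
Proof.
move=> x0 y0 xy; have yy := black_hat_bracket y0.
have xx := black_hat_bracket x0; have fy := black_hat_gt0 y.
have /black_hat_gap g : first_black_hat y < first_black_hat x.
  by rewrite -(ltr_pM2r y0); lra.
by rewrite eps_lt1//; nra.
Qed.

Lemma measurable_black_hat (R : realType) :
  measurable_fun setT (@first_black_hat R).
Proof.
have mpow : measurable_fun setT (fun t : R => 2 ^ (- Num.floor t) : R).
  apply: nonincreasing_measurable => // s t st.
  by rewrite ler_eXz2l ?ltr1n// lerN2 le_floor.
apply: (measurableT_comp mpow).
apply: measurable_funM; last exact: measurable_cst.
exact: measurable_ln.
Qed.

(** * Tonelli on a rectangle *)

(** Extending the integrand by zero outside the rectangle reduces the two
    statements to the whole product space. *)
Section Tonelli.
Context d1 d2 (T1 : measurableType d1) (T2 : measurableType d2) (R : realType).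
Variables (m1 : {sigma_finite_measure set T1 -> \bar R})
  (m2 : {sigma_finite_measure set T2 -> \bar R}).
Variables (A : set T1) (B : set T2) (f : T1 * T2 -> \bar R).
Hypotheses (mA : measurable A) (mB : measurable B).
Hypothesis mf : measurable_fun (A `*` B) f.
Hypothesis f0 : forall z, (A `*` B) z -> (0 <= f z)%E.

Let mfAB : measurable_fun setT (f \_ (A `*` B)).
Proof. exact/(measurable_restrictT _ (measurableX mA mB)). Qed.

Let fAB0 z : (0 <= (f \_ (A `*` B)) z)%E.
Proof. by rewrite patchE; case: ifPn => //; rewrite inE; exact: f0. Qed.

Let FE : fubini_F m2 (f \_ (A `*` B)) =
  (fun x => \int[m2]_(y in B) f (x, y))%E \_ A.
Proof.
apply/funext => x; rewrite /fubini_F patchE; case: ifPn => [|] xA.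
  rewrite [RHS]integral_mkcond; apply: eq_integral => y _.
  rewrite !patchE; congr (if _ then _ else _).
  by rewrite in_setX /= xA.
apply: integral0_eq => y _; rewrite patchE ifF//.
by apply/negbTE; rewrite in_setX /= (negbTE xA).
Qed.

Lemma tonelli_setX : (\int[m1 \x m2]_(z in A `*` B) f z =
  \int[m1]_(x in A) \int[m2]_(y in B) f (x, y))%E.
Proof.
by rewrite integral_mkcond (fubini_tonelli1 _ mfAB fAB0) FE -integral_mkcond.
Qed.

Lemma measurable_tonelli_setX :
  measurable_fun A (fun x => \int[m2]_(y in B) f (x, y))%E.
Proof.
by apply/measurable_restrictT => //; rewrite -FE; exact: measurable_fun_fubini_tonelli_F.
Qed.

End Tonelli.

(** * The payoff as an integral of gains *)

(** The completed sigma-algebra contains the Borel one, so that Borel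
    functions can be precomposed with this map. *)
Lemma lebesgueR_measurable_id (R : realType) :
  measurable_fun setT (fun x : lebesgueR R => x : R).
Proof. by move=> _ Y mY; rewrite setTI; exact: sub_caratheodory. Qed.

Section Game.
Variable R : realType.
Local Notation mu := (@completed_lebesgue_measure R).
Local Notation I := ([set` `[0%R, 1%R]] : set (lebesgueR R)).
Implicit Types (f g : R -> R) (x y a b c : R).

Lemma measurable_lebesgueR_itv (i : interval R) :
  measurable ([set` i] : set (lebesgueR R)).
Proof. by apply: sub_caratheodory; exact: measurable_itv. Qed.
#[local] Hint Resolve measurable_lebesgueR_itv : core.

Lemma completed_lebesgue_measure_itv (i : interval R) :
  mu [set` i] = (if i.1 < i.2 then (i.2 : \bar R) - i.1 else 0)%E.
Proof. exact: lebesgue_measure_itv. Qed.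

Definition integrand f g (z : lebesgueR R * lebesgueR R) : \bar R :=
  ((eps (f z.2 * z.1))%:~R * (eps (g z.1 * z.2))%:~R)%:E.

(** The contribution of the abscissa x to the payoff when the second player
    answers c there: an inner integral of [payoff]. *)
Definition gain f x c : \bar R :=
  (\int[mu]_(y in I) ((eps (f y * x))%:~R * (eps (c * y))%:~R)%:E)%E.

Lemma measurable_integrand f g : M1 f -> M1 g ->
  measurable_fun (I `*` I) (integrand f g).
Proof.
move=> [mf _] [mg _]; apply/measurable_EFinP.
have mI : measurable (I `*` I) by exact: measurableX.
have m1 : measurable_fun (I `*` I) (fun z => z.1 : R).
  apply: (measurableT_comp (@lebesgueR_measurable_id R)).
  exact: measurable_funTS measurable_fst.
have m2 : measurable_fun (I `*` I) (fun z => z.2 : R).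
  apply: (measurableT_comp (@lebesgueR_measurable_id R)).
  exact: measurable_funTS measurable_snd.
apply: measurable_funM;
  apply: (measurableT_comp (@measurable_eps R));
  apply: measurable_funM => //.
- apply: (measurable_comp _ _ mf) => //; first by move=> _ [z [_ ?] <-].
  exact: measurable_funTS measurable_snd.
- apply: (measurable_comp _ _ mg) => //; first by move=> _ [z [? _] <-].
  exact: measurable_funTS measurable_fst.
Qed.

Lemma integrand_ge0 f g z : (0 <= integrand f g z)%E.
Proof. by rewrite lee_fin mulr_ge0// eps_ge0. Qed.

Lemma payoff_gain f g : M1 f -> M1 g ->
  payoff f g = (\int[mu]_(x in I) gain f x (g x))%E.
Proof.
move=> Mf Mg; rewrite /payoff.
apply: (@tonelli_setX _ _ _ _ _ _ _ _ _ (integrand f g)) => //.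
  exact: measurable_integrand.
by move=> z _; exact: integrand_ge0.
Qed.

Lemma measurable_gain f g : M1 f -> M1 g ->
  measurable_fun I (fun x => gain f x (g x)).
Proof.
move=> Mf Mg.
apply: (@measurable_tonelli_setX _ _ _ _ _ _ _ _ (integrand f g)) => //.
  exact: measurable_integrand.
by move=> z _; exact: integrand_ge0.
Qed.

Lemma gain_ge0 f x c : (0 <= gain f x c)%E.
Proof. by apply: integral_ge0 => y _; rewrite lee_fin mulr_ge0// eps_ge0. Qed.

(** The end points of the unit interval form a null set, so gains need only be
    compared inside. This matters at x = 1: the dyadic block [1, 2[ of that point
    leaves the square, and the answer of the black hat there earns nothing. *)
Lemma payoff_le f g g' : M1 f -> M1 g -> M1 g' ->
  (forall x, 0 < x < 1 -> (gain f x (g x) <= gain f x (g' x))%E) ->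
  (payoff f g <= payoff f g')%E.
Proof.
move=> Mf Mg Mg' le; rewrite (payoff_gain Mf Mg) (payoff_gain Mf Mg').
apply: ae_ge0_le_integral.
- exact: measurable_lebesgueR_itv.
- by move=> x _; exact: gain_ge0.
- exact: measurable_gain.
- by move=> x _; exact: gain_ge0.
- exact: measurable_gain.
exists (`[0, 0] `|` `[1, 1]); split.
- exact: measurableU.
- apply/eqP; rewrite eq_le measure_ge0 andbT.
  apply: le_trans (measureU2 _ _ _) _ => //.
  change (mu [set` `[0, 0]%R] + mu [set` `[1, 1]%R] <= 0)%E.
  by rewrite !completed_lebesgue_measure_itv/= !ltxx adde0.
move=> x /= /not_implyP[]; rewrite in_itv/= => /andP[x0 x1] nle.
have [xp|xn] := ltP (0 : R) x; last by left; rewrite /= in_itv/= x0 xn.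
have [xl|xg] := ltP (x : R) 1; last by right; rewrite /= in_itv/= xg x1.
by exfalso; apply: nle; apply: le; rewrite xp xl.
Qed.

(** * At most half of an initial interval has digit one *)

Lemma measurable_eps_mul c (D : set (lebesgueR R)) :
  measurable_fun D (fun y : lebesgueR R => ((eps (c * y))%:~R : R)%:E).
Proof.
apply/measurable_EFinP; apply: measurable_funTS.
apply: (measurableT_comp (@measurable_eps R)).
apply: measurable_funM; first exact: measurable_cst.
exact: lebesgueR_measurable_id.
Qed.

Lemma integral_eps_split a m b c : a <= m <= b ->
  (\int[mu]_(y in `[a, b[) ((eps (c * y))%:~R : R)%:E =
   \int[mu]_(y in `[a, m[) ((eps (c * y))%:~R : R)%:E +
   \int[mu]_(y in `[m, b[) ((eps (c * y))%:~R : R)%:E)%E.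
Proof.
move=> /andP[am mb].
rewrite (@itv_bndbnd_setU _ _ _ (BLeft m)) ?bnd_simp//.
rewrite ge0_integral_setU; first by [].
- exact: measurable_lebesgueR_itv.
- exact: measurable_lebesgueR_itv.
- exact: measurable_eps_mul.
- by move=> y _; rewrite lee_fin eps_ge0.
- apply/disj_setPS => y /= []; rewrite !in_itv/= => /andP[_ ym] /andP[my _].
  by move: (lt_le_trans ym my); rewrite ltxx.
Qed.

Lemma integral_itv_cst1 a b : a <= b ->
  (\int[mu]_(y in `[a, b[) cst 1 y = (b - a)%:E)%E.
Proof.
move=> ab; rewrite integral_cst// mul1e.
rewrite [LHS](completed_lebesgue_measure_itv `[a, b[)/= lte_fin.
by case: ltP => // ba; rewrite (@le_anti _ _ a b) ?ab ?ba// subrr.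
Qed.

Lemma integral_eps_le a b c : a <= b ->
  (\int[mu]_(y in `[a, b[) ((eps (c * y))%:~R : R)%:E <= (b - a)%:E)%E.
Proof.
move=> ab; apply: (@le_trans _ _ (\int[mu]_(y in `[a, b[) (cst 1) y)%E).
  apply: ge0_le_integral.
  - exact: measurable_lebesgueR_itv.
  - by move=> y _; rewrite lee_fin eps_ge0.
  - exact: measurable_eps_mul.
  - exact: measurable_cst.
  - by move=> y _; rewrite lee_fin eps_le1.
by rewrite integral_itv_cst1.
Qed.

(** Along [0, a[, the function y |-> eps (c y) alternates between 0 and 1 on
    consecutive intervals of length 1/c, starting with 0. Each interval of
    ones, even when cut by a, is thus preceded by an interval of zeros that is
    at least as long. The induction is on the number of periods 2/c needed to
    cover [0, a[. *)
Lemma integral_eps_half a c : 0 <= c -> 0 <= a ->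
  (\int[mu]_(y in `[0%R, a[) ((eps (c * y))%:~R : R)%:E <= (a / 2)%:E)%E.
Proof.
rewrite (le_eqVlt 0 c) => /predU1P[<-|c0] a0.
  rewrite integral0_eq ?lee_fin ?divr_ge0// => y _.
  by rewrite mul0r eps_lt1//; lra.
have [n] : exists n : nat, a * c <= (2 * n)%:R.
  exists (Num.bound (a * c)); rewrite natrM.
  have := archi_boundP (mulr_ge0 a0 (ltW c0)).
  by move: (ler0n R (Num.bound (a * c))); lra.
elim: n a a0 => [|n IH] a a0 acn.
  have -> : a = 0 by move: acn; rewrite muln0 pmulr_lle0// => ?; lra.
  by rewrite set_itv_ge ?bnd_simp ?ltxx// integral_set0 mul0r.
have [/IH|nac] := leP (a * c) (2 * n)%:R; first exact.
pose b := (2 * n)%:R / c; have bc : b * c = (2 * n)%:R by rewrite divfK// gt_eqF.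
have b0 : 0 <= b by rewrite divr_ge0// ltW.
have ba : b < a by rewrite -(ltr_pM2r c0) bc.
rewrite (@integral_eps_split 0 b a c) ?b0 ?(ltW ba)//.
have -> : (a / 2 = b / 2 + (a - b) / 2)%R by lra.
rewrite EFinD; apply: leeD; first by apply: IH; rewrite ?bc.
(* [b, m[ is the zero half of the last, possibly incomplete, period. *)
pose m := Num.min a (b + c^-1).
have cV : c * c^-1 = 1 by rewrite mulfV// gt_eqF.
have bm : b <= m by rewrite le_min (ltW ba) lerDl invr_ge0 ltW.
have ma : m <= a by rewrite ge_min lexx.
rewrite (@integral_eps_split b m a c) ?bm ?ma//.
rewrite [X in (X + _)%E]integral0_eq ?add0e; last first.
  move=> y; rewrite /= in_itv/= => /andP[yb]; rewrite lt_min => /andP[_ yc].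
  rewrite (mulrC c) (@eps_even_block _ n)// -bc ler_pM2r// yb/=.
  by move: yc; rewrite -(ltr_pM2r c0) mulrDl mulVf ?gt_eqF.
apply: (le_trans (integral_eps_le c ma)); rewrite lee_fin.
have : a <= b + 2 / c.
  rewrite -(ler_pM2r c0) mulrDl bc divfK ?gt_eqF//.
  by move: acn; rewrite mulnS natrD addrC.
by rewrite /m; case: (leP a (b + c^-1)); lra.
Qed.

(** * Gains against the first black hat *)

Lemma M1_black_hat : M1 (@first_black_hat R).
Proof.
split=> [|x _]; last by rewrite ltW// black_hat_gt0.
apply: measurable_funTS.
exact: (measurableT_comp (@measurable_black_hat R) (@lebesgueR_measurable_id R)).
Qed.

Local Notation f0 := (@first_black_hat R).

Lemma measurable_black_hat_integrand x c (D : set (lebesgueR R)) :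
  measurable_fun D
    (fun y : lebesgueR R => ((eps (f0 y * x))%:~R * (eps (c * y))%:~R : R)%:E).
Proof.
apply/measurable_EFinP; apply: measurable_funM; last first.
  exact/measurable_EFinP/measurable_eps_mul.
apply: measurable_funTS; apply: (measurableT_comp (@measurable_eps R)).
apply: measurable_funM; last exact: measurable_cst.
exact: (measurableT_comp (@measurable_black_hat R) (@lebesgueR_measurable_id R)).
Qed.

(** Only the y below a = 2 / f0(x), the right end of the dyadic block of x, can
    contribute, and at most half of them have eps (c y) = 1. *)
Lemma gain_black_hat_le x c : 0 < x < 1 -> 0 <= c ->
  (gain f0 x c <= (f0 x)^-1%:E)%E.
Proof.
move=> x01 c0; have f2 := black_hat_ge2 x01; have fx := black_hat_gt0 x.
have x0 : 0 < x by case/andP: x01.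
pose a := 2 / f0 x; have a0 : 0 < a by rewrite divr_gt0.
have a1 : a <= 1 by rewrite ler_pdivrMr// mul1r.
have fa : f0 x * a = 2 by rewrite mulrC divfK// gt_eqF.
rewrite /gain (@itv_bndbnd_setU _ _ _ (BLeft a)) ?bnd_simp ?(ltW a0)//.
rewrite ge0_integral_setU; first last.
- apply/disj_setPS => y /= []; rewrite !in_itv/= => /andP[_ ya] /andP[ay _].
  by move: (lt_le_trans ya ay); rewrite ltxx.
- by move=> y _; rewrite lee_fin mulr_ge0// eps_ge0.
- exact: measurable_black_hat_integrand.
- exact: measurable_lebesgueR_itv.
- exact: measurable_lebesgueR_itv.
rewrite [X in (_ + X)%E]integral0_eq ?adde0; last first.
  move=> y; rewrite /= in_itv/= => /andP[ay _].
  rewrite (@black_hat_digit0 _ x y) ?mul0r ?(lt_le_trans a0 ay)//.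
  by rewrite -[leLHS]fa ler_pM2l.
have -> : (f0 x)^-1 = a / 2 by rewrite /a mulrAC divff ?mul1r.
apply: le_trans (integral_eps_half c0 (ltW a0)).
apply: ge0_le_integral.
- exact: measurable_lebesgueR_itv.
- by move=> y _; rewrite lee_fin mulr_ge0// eps_ge0.
- exact: measurable_black_hat_integrand.
- exact: measurable_eps_mul.
- by move=> y _; rewrite lee_fin ler_piMl ?eps_ge0 ?eps_le1.
Qed.

(** The dyadic block of x has length 1 / f0(x), and both digits are 1 on it. *)
Lemma gain_black_hat_ge x : 0 < x < 1 -> ((f0 x)^-1%:E <= gain f0 x (f0 x))%E.
Proof.
move=> x01; have f2 := black_hat_ge2 x01; have fx := black_hat_gt0 x.
have x0 : 0 < x by case/andP: x01.
pose b := (f0 x)^-1; have b0 : 0 < b by rewrite invr_gt0.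
have fb : f0 x * b = 1 by rewrite mulfV// gt_eqF.
have b1 : 2 * b <= 1 by rewrite -(ler_pM2l fx); nra.
apply: (@le_trans _ _ (\int[mu]_(y in `[b, (2 * b)%R[)
   ((eps (f0 y * x))%:~R * (eps (f0 x * y))%:~R : R)%:E)%E).
  rewrite (eq_integral (cst 1%E)); last first.
    move=> y; rewrite inE/= in_itv/= => /andP[yb y2b].
    have bl : 1 <= f0 x * y < 2 by nra.
    rewrite (black_hat_same_block _ bl) ?(lt_le_trans b0 yb)//.
    by rewrite !eps_ge1_lt2 ?mulr1//; exact: black_hat_bracket.
  by rewrite integral_itv_cst1 ?lee_fin -/b; lra.
apply: ge0_subset_integral.
- exact: measurable_lebesgueR_itv.
- exact: measurable_lebesgueR_itv.
- exact: measurable_black_hat_integrand.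
- by move=> y _; rewrite lee_fin mulr_ge0// eps_ge0.
- by move=> y; rewrite /= !in_itv/= => /andP[yb y2b]; apply/andP; lra.
Qed.

Lemma payoff_black_hat_le g g' : M1 g -> M1 g' ->
  (forall x, 0 < x < 1 -> g' x = f0 x) -> (payoff f0 g <= payoff f0 g')%E.
Proof.
move=> Mg Mg' g'E; apply: payoff_le => //; first exact: M1_black_hat.
move=> x x01; rewrite (g'E _ x01).
apply: (le_trans _ (gain_black_hat_ge x01)).
apply: gain_black_hat_le => //; apply: Mg.2.
by case/andP: x01 => /ltW x0 /ltW x1; rewrite in_itv/= x0.
Qed.

Lemma ereal_sup_payoff_black_hat g : M1 g ->
  (forall x, 0 < x < 1 -> g x = f0 x) ->
  ereal_sup [set payoff f0 g' | g' in @M1 R] = payoff f0 g.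
Proof.
move=> Mg gE; apply/eqP; rewrite eq_le; apply/andP; split.
  by apply: ge_ereal_sup => _ [g' Mg' <-]; exact: payoff_black_hat_le.
by apply: ereal_sup_ubound; exists g.
Qed.

(** * The black hat as a power of two with positive exponents *)

(** On ]0, 1[ the floor is negative, and its absolute value is the exponent of
    the black hat. The maximum with 1 serves the point 0, where the floor is
    0. *)
Definition black_hat_exponent x : nat := maxn 1 `|Num.floor (ln x / ln 2)|%N.

(** The sigma-algebra on the natural numbers is generated by the final
    segments, and their preimages are preimages of real half-lines. *)
Lemma measurable_black_hat_exponent : measurable_fun setT black_hat_exponent.
Proof.
apply: measurable_fun_maxn; first exact: measurable_cst.
pose h x := `|Num.floor (ln x / ln 2)|%N.
have mh : measurable_fun setT (fun x => (h x)%:R : R).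
  under eq_fun do rewrite /h natr_absz intr_norm.
  apply: measurableT_comp; first exact: normr_measurable.
  apply: (measurableT_comp (@measurable_floor R)).
  by apply: measurable_funM; [exact: measurable_ln|exact: measurable_cst].
move=> mT; apply: (measurability _ NGenCInfty.measurableE) => //.
move=> /= _ [_ [n ->] <-].
have := mh mT _ (measurable_itv `[n%:R, +oo[).
congr (measurable (_ `&` _)); apply/seteqP.
by split=> x /=; rewrite !in_itv/= !andbT ler_nat leEnat.
Qed.

Lemma pow_black_hat_exponent x :
  0 < x < 1 -> 2 ^+ black_hat_exponent x = f0 x.
Proof.
move=> /black_hat_ge2; rewrite /black_hat_exponent /first_black_hat.
rewrite -[leLHS]expr1z ler_eXz2l ?ltr1n//.
rewrite lerNr; case: (Num.floor _) => n n1; first by move: n1; lia.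
by rewrite NegzE opprK abszN (maxn_idPr _).
Qed.

Lemma S1_black_hat_exponent : S1 black_hat_exponent.
Proof.
split=> [|x _]; last by rewrite leq_max.
apply: measurable_funTS.
exact: (measurableT_comp measurable_black_hat_exponent (@lebesgueR_measurable_id R)).
Qed.

Lemma M1_pow_black_hat_exponent : M1 (fun x => 2 ^+ black_hat_exponent x).
Proof.
split=> [|x _]; last by rewrite exprn_ge0.
have mpow : measurable_fun setT (fun n : nat => 2 ^+ n : R) by [].
apply: measurable_funTS; apply: (measurableT_comp mpow).
exact: (measurableT_comp measurable_black_hat_exponent (@lebesgueR_measurable_id R)).
Qed.

End Game.

Theorem proposition37 (R : realType) :
  [/\ M1 (@first_black_hat R),
      ereal_sup [set payoff (@first_black_hat R) g | g in @M1 R] =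
        payoff (@first_black_hat R) (@first_black_hat R)
    & exists2 f : R -> R, M1 f &
      exists2 g : R -> R, pow2S1 g &
        payoff f g = ereal_sup [set payoff f g' | g' in @M1 R]].
Proof.
split; [exact: M1_black_hat | |].
  by apply: ereal_sup_payoff_black_hat => //; exact: M1_black_hat.
exists (@first_black_hat R); first exact: M1_black_hat.
exists (fun x => 2 ^+ black_hat_exponent x).
  by exists (@black_hat_exponent R) => //; exact: S1_black_hat_exponent.
apply/esym/ereal_sup_payoff_black_hat.
- exact: M1_pow_black_hat_exponent.
- exact: pow_black_hat_exponent.
Qed.
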